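(* Let $\Lambda=(W_j,\Lambda_j,v_j)_{j\in\mathbb{J}}$ be a g-fusion frame for $H$ with g-fusion frame operator $S_\Lambda$. Then $(S_\Lambda^{-1}W_j,\ \Lambda_j\pi_{W_j}S_\Lambda^{-1},\ v_j)_{j\in\mathbb{J}}$ is a g-fusion frame for $H$.
   Context: $H$ is a separable Hilbert space, $\mathbb{J}\subseteq\mathbb{Z}$, and $\{H_j\}_{j\in\mathbb{J}}$ is a family of Hilbert spaces. $\mathcal{B}(H,H_j)$ is the set of bounded linear operators from $H$ to $H_j$, and $\pi_V$ is the orthogonal projection of $H$ onto a closed subspace $V$. A triple $\Lambda=(W_j,\Lambda_j,v_j)_{j\in\mathbb{J}}$, where each $W_j$ is a closed subspace of $H$, $\Lambda_j\in\mathcal{B}(H,H_j)$ and $v_j>0$, is a g-fusion frame for $H$ if there exist $0<A\le B<\infty$ such that $A\|f\|^2\le\sum_{j\in\mathbb{J}}v_j^2\|\Lambda_j\pi_{W_j}f\|^2\le B\|f\|^2$ for all $f\in H$. Its g-fusion frame operator is $S_\Lambda:H\to H$, $S_\Lambda f=\sum_{j\in\mathbb{J}}v_j^2\pi_{W_j}\Lambda_j^*\Lambda_j\pi_{W_j}f$, a bounded, positive, invertible operator. *)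

(* Defs.v *)
From HB Require Import structures.
From mathcomp Require Import all_boot all_order all_algebra finmap sesquilinear.
From mathcomp Require Import complex.
From mathcomp Require Import all_classical all_reals all_analysis.
From mathcomp Require Import summability.

Set Implicit Arguments.
Unset Strict Implicit.
Unset Printing Implicit Defensive.

Import Order.TTheory GRing.Theory Num.Theory.
Import numFieldNormedType.Exports.

Local Open Scope classical_set_scope.
Local Open Scope ring_scope.

(* The scalars K are either the real numbers or the complex numbers, and conj
   is the conjugation used to state sesquilinearity. In both cases the norms
   live in K, and 0 < a (resp. 0 <= a) entails that a is a real number: for
   R[i] the order relation is the partial order with
   a <= b iff b - a is a nonnegative real. *)
Variant real_or_complex (R : realType) :
    forall K : numFieldType, (K -> K) -> Prop :=
| RealScalars : @real_or_complex R R idfun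
| ComplexScalars : @real_or_complex R R[i] (@conjc R).

(* The inner product is linear in its first argument. *)
HB.mixin Record isHilbert (K : numFieldType) (conj : K -> K) (H : Type)
    of CompleteNormedModule K H := {
  dot : {dot H for conj} ;
  dotE : forall x : H, `|x| ^+ 2 = dot x x
}.

#[short(type="hilbertType")]
HB.structure Definition Hilbert (K : numFieldType) (conj : K -> K) :=
  { H of CompleteNormedModule K H & isHilbert K conj H }.

Definition separable (T : topologicalType) :=
  exists2 D : set T, countable D & dense D.

Section HilbertSpaces.
Context {K : numFieldType} {conj : K -> K}.

Section Operators.
Context {H H' : hilbertType conj}.

Definition bounded_operator (L : H -> H') :=
  linear L /\ exists M : K, forall x, `|L x| <= M * `|x|.

(* For a bounded operator L, adjoint L y is the unique z (Riesz) such that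
   <L x, y> = <x, z> for all x. *)
Definition adjoint (L : H -> H') (y : H') : H :=
  xget 0 [set z | forall x, dot (L x) y = dot x z].

End Operators.

Section Subspaces.
Context {H : hilbertType conj}.

Definition closed_subspace (W : set H) :=
  [/\ W 0, (forall a x y, W x -> W y -> W (a *: x + y)) & closed W].

(* For a closed subspace W, orth_proj W f is the unique p in W such that f - p is
   orthogonal to W. *)
Definition orth_proj (W : set H) (f : H) : H :=
  xget 0 [set p | W p /\ forall w, W w -> dot (f - p) w = 0].

End Subspaces.

Section GFusionFrames.
Context {H : hilbertType conj} {J : set int} {H_ : J -> hilbertType conj}.
Implicit Types (W : J -> set H) (L : forall j, H -> H_ j) (v : J -> K).

(* Sums over J are unordered sums, i.e., limits of the partial sums along the
   directed set of the finite subsets of J. *)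
Definition gfusion_frame W L v :=
  [/\ forall j, closed_subspace (W j),
      forall j, bounded_operator (L j),
      forall j, 0 < v j &
      exists A B : K, [/\ 0 < A, A <= B &
        forall f : H,
          let u j : K^o := v j ^+ 2 * `|L j (orth_proj (W j) f)| ^+ 2 in
          [/\ cvg (partial_sum u @ totally),
              A * `|f| ^+ 2 <= sum u & sum u <= B * `|f| ^+ 2]]].

Definition gfusion_frame_operator W L v (f : H) : H :=
  sum (fun j => v j ^+ 2 *: orth_proj (W j) (adjoint (L j) (L j (orth_proj (W j) f)))).

End GFusionFrames.

End HilbertSpaces.

(* Main.v *)
Require Import Defs.
From mathcomp Require Import all_boot all_order all_algebra finmap.
From mathcomp Require Import sesquilinear complex.
From mathcomp Require Import all_classical all_reals all_analysis.
From mathcomp Require Import summability.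
From mathcomp Require Import ring lra.

Set Implicit Arguments.
Unset Strict Implicit.
Unset Printing Implicit Defensive.

Import Order.TTheory GRing.Theory Num.Theory.
Import numFieldNormedType.Exports.

Local Open Scope classical_set_scope.
Local Open Scope ring_scope.

(** Write [P j] for [orth_proj (W j)] and [T j] for the positive operator
    [v j ^+ 2 *: P j (adjoint (L j) (L j (P j _)))], so that [S] is the sum of the
    [T j] and [dot (T j f) f] is the [j]-th term of the frame series at [f].

    Once [S] is known to be a self-adjoint bijection, so is [Sinv].  A vector [g]
    orthogonal to the image of [W j] under [Sinv] satisfies
    [dot (Sinv g) w = dot g (Sinv w) = 0] for [w] in [W j], that is,
    [P j (Sinv g) = 0].  Hence projecting [f] onto that image does not change
    [P j (Sinv f)] ([orth_proj_image]), and the series of the new family at [f] is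
    the series of the old one at [Sinv f].  It therefore converges and lies between
    [A * `|Sinv f| ^+ 2] and [B * `|Sinv f| ^+ 2]; since
    [A * `|Sinv f| <= `|f| <= B * `|Sinv f|], the new family has the frame bounds
    [A / B ^+ 2] and [B / A ^+ 2].

    Two things have to be shown about [S].

    The defining sum converges and yields a self-adjoint operator with
    [A * `|f| ^+ 2 <= dot (S f) f <= B * `|f| ^+ 2]
    ([gfusion_frame_operator_spec]).  For a positive self-adjoint [Q] bounded by
    [B], Cauchy-Schwarz for the form [dot (Q x) y] gives
    [`|Q f| ^+ 2 <= B * dot (Q f) f] ([selfadjoint_quadratic_bound]).  Applied to
    finite sums of the [T j], it bounds the increments of the vector sum by those of
    the scalar series, so the net of partial sums is Cauchy.

    [S] is bijective ([coercive_bij]).  Its surjectivity, the existence of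
    orthogonal projections and that of adjoints are three instances of a single
    variational principle ([form_represents]): for a coercive bounded symmetric form
    [a] and a bounded functional [l], the function [a u u - 2 * l u] has a minimizer
    on each closed subspace, where [a u w = l w] for all [w] of the subspace.

    The estimates are carried out in [R], whose order is total and which has
    infima, for the real part of the inner product; the two kinds of scalars are
    treated together by means of [real_structure]. *)

(** * Scalars *)

(** What the arguments below use of the real and of the complex scalars: the copy
    of [R] inside [K], the real part, and the conjugation. *)
Record real_structure (R : realType) (K : numFieldType) (conj : K -> K) :=
  RealStructure {
    inj : {rmorphism R -> K};
    re : K -> R;
    reD : {morph re : x y / x + y};
    re_injM : forall r x, re (inj r * x) = r * re x;
    re_le : forall x, re x <= re `|x|;
    re1 : re 1 = 1;
    inj_re : forall x, 0 <= x -> inj (re x) = x;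
    inj_ge0 : forall r, (0 <= inj r) = (0 <= r);
    re_conj : forall x, re (conj x) = re x;
    conj_inj : forall r, conj (inj r) = inj r;
    conjM : {morph conj : x y / x * y};
    mul_conj : forall x, x * conj x = `|x| ^+ 2
  }.

Lemma real_structure_exists (R : realType) (K : numFieldType) (conj : K -> K) :
  real_or_complex R conj -> inhabited (real_structure R conj).
Proof.
case; constructor.
- apply: (@RealStructure R R idfun idfun idfun) => //= x.
  + exact: ler_norm.
  + by rewrite -normrX ger0_norm ?sqr_ge0.
- apply: (@RealStructure R R[i] (@conjc R) (real_complex R) (@complex.Re R)) => //=.
  + by move=> [a b] [c d].
  + by move=> r [a b] /=; rewrite mul0r subr0.
  + move=> x; have := normc_ge_Re x; rewrite lecE => /andP[_].
    exact/le_trans/ler_norm.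
  + by move=> x x0; apply: RRe_real; exact: ger0_real.
  + by move=> r; exact: ler0c.
  + by case.
  + exact: conjc_real.
  + exact: rmorphM.
  + by move=> x; apply/esym/sqr_normc.
Qed.

Section Scalars.
Context (R : realType) (K : numFieldType) (conj : K -> K).
Context (rs : real_structure R conj).
Local Notation io := (inj rs).
Local Notation re := (re rs).

Lemma re0 : re 0 = 0.
Proof. by apply: (addrI (re 0)); rewrite -reD !addr0. Qed.

Lemma reN x : re (- x) = - re x.
Proof. by apply: (addrI (re x)); rewrite -reD !subrr re0. Qed.

Lemma reB x y : re (x - y) = re x - re y.
Proof. by rewrite reD reN. Qed.

Lemma re_inj r : re (io r) = r.
Proof. by rewrite -[io r]mulr1 re_injM re1 mulr1. Qed.

Lemma re_ge0 x : 0 <= x -> 0 <= re x.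
Proof. by move=> x0; rewrite -(inj_ge0 rs) inj_re. Qed.

Lemma inj_le r s : (io r <= io s) = (r <= s).
Proof. by rewrite -subr_ge0 -rmorphB inj_ge0 subr_ge0. Qed.

Lemma inj_lt r s : (io r < io s) = (r < s).
Proof. by rewrite !lt_neqAle inj_le (inj_eq (fmorph_inj io)). Qed.

Lemma real_scalar x : 0 <= x -> exists2 r, 0 <= r & x = io r.
Proof. by move=> x0; exists (re x); [exact: re_ge0|rewrite inj_re]. Qed.

Lemma pos_scalar x : 0 < x -> exists2 r, 0 < r & x = io r.
Proof.
move=> x0; exists (re x); last by rewrite inj_re // ltW.
by rewrite -inj_lt rmorph0 inj_re // ltW.
Qed.

End Scalars.

(** * Real parts of inner products *)

Section Hilbert.
Context (R : realType) (K : numFieldType) (conj : K -> K).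
Context (rs : real_structure R conj).
Local Notation io := (inj rs).
Local Notation re := (re rs).

Section Inner.
Context (H : hilbertType conj).
Implicit Types x y z : H.

Lemma dotC x y : dot x y = conj (dot y x).
Proof. by rewrite hermitian_subproof expr0 mul1r. Qed.

Lemma dotDl x y z : dot (x + y) z = dot x z + dot y z.
Proof. by rewrite linearDl. Qed.

Lemma dotZl c x y : dot (c *: x) y = c * dot x y.
Proof. by rewrite linearZl_LR. Qed.

Lemma dotNl x y : dot (- x) y = - dot x y.
Proof. by rewrite -scaleN1r dotZl mulN1r. Qed.

Lemma dotBl x y z : dot (x - y) z = dot x z - dot y z.
Proof. by rewrite dotDl dotNl. Qed.

Lemma dotDr x y z : dot z (x + y) = dot z x + dot z y.
Proof. by rewrite linearDr. Qed.

Lemma dotZr c x y : dot y (c *: x) = conj c * dot y x.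
Proof. by rewrite linearZr_LR. Qed.

Lemma dot_injr r x y : dot y (io r *: x) = io r * dot y x.
Proof. by rewrite dotZr conj_inj. Qed.

Lemma dot0l x : dot 0 x = 0.
Proof. by rewrite -(scale0r 0) dotZl mul0r. Qed.

Lemma dot_suml (I : Type) (r : seq I) (F : I -> H) x :
  dot (\sum_(i <- r) F i) x = \sum_(i <- r) dot (F i) x.
Proof.
by elim/big_rec2: _ => [|i a b _ <-]; rewrite ?dot0l ?dotDl.
Qed.

Lemma dot_sumr (I : Type) (r : seq I) (F : I -> H) x :
  dot x (\sum_(i <- r) F i) = \sum_(i <- r) dot x (F i).
Proof.
elim: r => [|i r IH]; last by rewrite !big_cons dotDr IH.
by rewrite !big_nil -(subrr x) dotDr -scaleN1r -(rmorph1 io) -rmorphN dot_injr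
  rmorphN rmorph1 mulN1r subrr.
Qed.

Definition rdot x y : R := re (dot x y).

Definition rnorm x : R := re `|x|.

Lemma norm_rnorm x : `|x| = io (rnorm x).
Proof. by rewrite /rnorm inj_re. Qed.

Lemma rnorm_ge0 x : 0 <= rnorm x.
Proof. exact: re_ge0. Qed.

Lemma rdotxx x : rdot x x = rnorm x ^+ 2.
Proof. by rewrite /rdot -dotE norm_rnorm -rmorphXn re_inj. Qed.

Lemma rnorm0_eq0 x : rnorm x = 0 -> x = 0.
Proof. by move=> x0; apply/eqP; rewrite -normr_eq0 norm_rnorm x0 rmorph0. Qed.

Definition symmetric_form (a : H -> H -> R) :=
  [/\ forall x y, a x y = a y x,
      forall x y z, a (x + y) z = a x z + a y z &
      forall r x y, a (io r *: x) y = r * a x y].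

Lemma rdot_form : symmetric_form rdot.
Proof.
split=> *; rewrite /rdot.
- by rewrite dotC re_conj.
- by rewrite dotDl reD.
- by rewrite dotZl re_injM.
Qed.

Lemma form_expand a : symmetric_form a -> forall x y t,
  a (x + io t *: y) (x + io t *: y) = a x x + 2 * t * a x y + t ^+ 2 * a y y.
Proof.
move=> [aC aD aZ] x y t.
rewrite aD aZ (aC x (_ + _)) (aC y (_ + _)) !aD !aZ (aC y x); ring.
Qed.

Lemma discriminant (p q r : R) : 0 <= r ->
  (forall t, 0 <= p + 2 * t * q + t ^+ 2 * r) -> q ^+ 2 <= p * r.
Proof.
rewrite le_eqVlt => /predU1P[<- h|r0 /(_ (- (q / r)))].
  have [->|q0] := eqVneq q 0; first by rewrite expr0n mulr0.
  (* With [r = 0] the polynomial is affine; at this [t] its value is [-1]. *)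
  have := h (- ((p + 1) / (2 * q))).
  have -> : p + 2 * - ((p + 1) / (2 * q)) * q + (- ((p + 1) / (2 * q))) ^+ 2 * 0
    = -1 by field.
  by rewrite oppr_ge0 ler10.
have -> : p + 2 * - (q / r) * q + (- (q / r)) ^+ 2 * r = (p * r - q ^+ 2) / r.
  by field; rewrite gt_eqF.
by rewrite pmulr_lge0 ?invr_gt0 // subr_ge0.
Qed.

(** The quadratic polynomial [a (x + t y) (x + t y)] in [t] is nonnegative. *)
Lemma form_CauchySchwarz a : symmetric_form a -> (forall x, 0 <= a x x) ->
  forall x y, a x y ^+ 2 <= a x x * a y y.
Proof.
move=> af a0 x y; apply: discriminant => // t.
by rewrite -form_expand.
Qed.

Lemma rdot_le x y : `|rdot x y| <= rnorm x * rnorm y.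
Proof.
rewrite -(@ler_pXn2r _ 2) ?nnegrE ?mulr_ge0 ?rnorm_ge0 //.
rewrite real_normK ?num_real // exprMn -!rdotxx.
by apply: form_CauchySchwarz; [exact: rdot_form|move=> z; rewrite rdotxx sqr_ge0].
Qed.

(** Multiplying [y] by the scalar [dot x y] makes the inner product a nonnegative
    real, which reduces the bound to that for the real part. *)
Lemma dot_le x y : `|dot x y| <= io (rnorm x * rnorm y).
Proof.
have [r r0 e] := real_scalar rs (normr_ge0 (dot x y)).
rewrite e inj_le.
have [->|r1] := eqVneq r 0; first by rewrite mulr_ge0 ?rnorm_ge0.
have := rdot_le x (dot x y *: y).
have -> : rnorm (dot x y *: y) = r * rnorm y.
  by rewrite /rnorm normrZ e re_injM.
rewrite /rdot dotZr mulrC (mul_conj rs) e -rmorphXn re_inj.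
rewrite ger0_norm ?sqr_ge0 // expr2 mulrCA ler_pM2l //.
by rewrite lt_neqAle eq_sym r1.
Qed.

Lemma rnorm_cvg (F : set_system H) {FF : Filter F} p e :
  F --> p -> 0 < e -> F [set u | rnorm (p - u) < e].
Proof.
move=> Fp e0.
have : 0 < io e by rewrite -(rmorph0 io) inj_lt.
move/cvgrPdist_lt : Fp => /[apply]; apply: filterS => u /=.
by rewrite norm_rnorm inj_lt.
Qed.


(** * Minimization over a closed subspace *)

Lemma subspaceD (W : set H) x y : closed_subspace W -> W x -> W y -> W (x + y).
Proof. by move=> [_ h _] Wx Wy; rewrite -(scale1r x); exact: h. Qed.

Lemma subspaceZ (W : set H) c x : closed_subspace W -> W x -> W (c *: x).
Proof. by move=> [h0 h _] Wx; rewrite -(addr0 (_ *: _)); exact: h. Qed.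

(** Minimize [J u := a u u - 2 * l u] over [W].  Coercivity bounds [J] from below,
    and by the parallelogram identity two elements of [W] whose values are within [d]
    of the infimum are at distance at most a multiple of [Num.sqrt d]; the near
    minimizers thus form a Cauchy filter.  At a near minimizer [u] the polynomial
    [J (u + t w)] in [t] stays above the infimum, which makes [a u w - l w] small,
    and this passes to the limit. *)
Lemma form_represents (a : H -> H -> R) (A B M : R) (l : H -> R) (W : set H) :
  symmetric_form a -> 0 < A ->
  (forall x, A * rnorm x ^+ 2 <= a x x) ->
  (forall x, a x x <= B * rnorm x ^+ 2) ->
  {morph l : x y / x + y} -> (forall r x, l (io r *: x) = r * l x) ->
  (forall x, l x <= M * rnorm x) ->
  closed_subspace W ->
  exists2 u, W u & forall w, W w -> a u w = l w.
Proof.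
move=> af A0 aA aB lD lZ lM Ws.
have [aC aD aZ] := af.
have a_ge0 x : 0 <= a x x.
  by apply: le_trans (aA x); rewrite mulr_ge0 ?sqr_ge0 // ltW.
pose J u := a u u - 2 * l u.
have JE u w t : J (u + io t *: w) = J u + 2 * t * (a u w - l w) + t ^+ 2 * a w w.
  by rewrite /J form_expand // lD lZ; ring.
have Jge u : - (M ^+ 2 / A) <= J u.
  have := aA u; have := lM u; rewrite /J.
  move: (rnorm u) (a u u) (l u) => h x y yh hx.
  have e : M ^+ 2 / A + A * h ^+ 2 - 2 * (M * h) = (A * h - M) ^+ 2 / A.
    by field; rewrite gt_eqF.
  have : 0 <= (A * h - M) ^+ 2 / A by rewrite divr_ge0 ?sqr_ge0 // ltW.
  rewrite -e; lra.
pose E := J @` W.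
have W0 : W 0 by case: Ws.
have Einf : has_inf E.
  split; first by exists (J 0), 0.
  by exists (- (M ^+ 2 / A)) => _ [u _ <-].
pose m := inf E.
have mJ u : W u -> m <= J u.
  by move=> Wu; apply: ge_inf; [case: Einf|exists u].
have Jm e : 0 < e -> exists2 u, W u & J u < m + e.
  by move=> e0; have [_ [u Wu <-] ?] := inf_adherent e0 Einf; exists u.
have close u w d : W u -> W w -> J u < m + d -> J w < m + d ->
    A * rnorm (u - w) ^+ 2 < 4 * d.
  move=> Wu Ww ud wd; apply: le_lt_trans (aA _) _.
  (* The midpoint of [u] and [w] also has a value at least [m]. *)
  have Wz : W (w + io 2^-1 *: (u - w)).
    apply: (subspaceD Ws Ww); apply: (subspaceZ _ Ws); apply: (subspaceD Ws Wu).
    by rewrite -scaleN1r; apply: subspaceZ.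
  have := mJ _ Wz; rewrite JE.
  have := JE w (u - w) 1; rewrite rmorph1 scale1r subrKC.
  move: (a _ _) (a w _ - _) => s t Ju; rewrite Ju in ud; lra.
pose D := [set e : R | 0 < e].
pose B_ e := [set u | W u /\ J u < m + e].
pose F : set_system H := filter_from D B_.
have FF : ProperFilter F.
  apply: filter_from_proper.
    apply: filter_from_filter; first by exists 1; exact: ltr01.
    move=> i j i0 j0; exists (Num.min i j); first by rewrite /D /= lt_min i0.
    move=> u [Wu]; rewrite -ltrBlDl lt_min => /andP[ui uj].
    by split; split=> //; rewrite -ltrBlDl.
  by move=> e /Jm[u Wu ue]; exists u.
have /cauchy_cvg Fp : cauchy F.
  apply: cauchy_exP => eps /(pos_scalar rs)[e e0 ->].
  have d0 : 0 < A * e ^+ 2 / 4 by rewrite divr_gt0 // mulr_gt0 // exprn_gt0.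
  have [x Wx xd] := Jm _ d0.
  exists x; exists (A * e ^+ 2 / 4) => // u [Wu ud] /=.
  rewrite -ball_normE /= norm_rnorm inj_lt.
  rewrite -(@ltr_pXn2r _ 2) ?nnegrE ?rnorm_ge0 ?(ltW e0) //.
  have := close _ _ _ Wx Wu xd ud.
  have -> : 4 * (A * e ^+ 2 / 4) = A * e ^+ 2 by field.
  by rewrite ltr_pM2l.
set p := lim F in Fp.
have Fnear e d : 0 < e -> 0 < d -> exists u, [/\ W u, J u < m + e & rnorm (p - u) < d].
  move=> e0 d0.
  have h1 : F (B_ e) by exists e.
  have h2 : F [set u | rnorm (p - u) < d] by exact: rnorm_cvg.
  have [u [[? ?] ?]] := filter_ex (filterI h1 h2).
  by exists u.
exists p.
  have [_ _ Wcl] := Ws; apply: Wcl => N pN.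
  have h1 : F (B_ 1) by exists 1 => //; exact: ltr01.
  have [u [[? ?] ?]] := filter_ex (filterI h1 (Fp _ pN)).
  by exists u.
move=> w Ww; apply/eqP; rewrite -subr_eq0; apply/eqP.
set q := a p w - l w; apply/eqP; apply: contraT => q0.
have C0 := a_ge0 w; set C := a w w in C0.
(* If [q] were nonzero, this [e], and a [u] that is [e]-minimizing and close to [p],
   would give [q ^+ 2 <= 4 * (e * C) < q ^+ 2]. *)
have e0 : 0 < q ^+ 2 / (8 * (C + 1)).
  apply: divr_gt0; first by rewrite exprn_even_gt0.
  by apply: mulr_gt0 => //; rewrite ltr_wpDl.
set e := _ / _ in e0.
have B0 : 0 < `|B| + 1 by rewrite ltr_wpDl.
have d0 : 0 < Num.sqrt (e / (`|B| + 1)) by rewrite sqrtr_gt0 divr_gt0.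
have [u [Wu ue ud]] := Fnear _ _ e0 d0.
have h1 : (a u w - l w) ^+ 2 <= e * C.
  apply: discriminant => // t.
  have := mJ _ (subspaceD Ws Wu (subspaceZ (io t) Ws Ww)); rewrite JE -/C; lra.
have h2 : a (p - u) w ^+ 2 <= e * C.
  apply: le_trans (form_CauchySchwarz af a_ge0 _ _) _.
  rewrite ler_wpM2r //; apply: le_trans (aB _) _.
  have h3 : rnorm (p - u) ^+ 2 <= e / (`|B| + 1).
    have /sqr_sqrtr <- : 0 <= e / (`|B| + 1) by rewrite divr_ge0 // ltW.
    by rewrite ler_pXn2r ?nnegrE ?rnorm_ge0 ?sqrtr_ge0 // ltW.
  move: h3; rewrite ler_pdivlMr // mulrC => h3.
  apply: le_trans h3; rewrite ler_wpM2r ?sqr_ge0 //.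
  by apply: le_trans (ler_norm _) _; rewrite lerDl.
have qE : q = a (p - u) w + (a u w - l w).
  by rewrite /q addrA -aD subrK.
have : q ^+ 2 <= 4 * (e * C).
  rewrite qE; move: (a _ w) (a u w - _) h1 h2 => x y h1 h2.
  have := sqr_ge0 (x - y); nra.
have : e * (8 * (C + 1)) = q ^+ 2.
  by rewrite /e mulfVK // gt_eqF // mulr_gt0 // ltr_wpDl.
have : 0 <= e * C by rewrite mulr_ge0 // ltW.
lra.
Qed.

(** * Projections, adjoints and self-adjoint operators *)

(** Replacing [x] by [conj (d x) *: x] turns [re (d x)] into [`|d x| ^+ 2]. *)
Lemma scalar_re_eq0 (d : H -> K) (W : set H) :
  (forall c x, W x -> W (c *: x)) -> (forall c x, d (c *: x) = c * d x) ->
  (forall x, W x -> re (d x) = 0) -> forall x, W x -> d x = 0.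
Proof.
move=> WZ dZ d0 x Wx; have := d0 _ (WZ (conj (d x)) _ Wx).
rewrite dZ mulrC (mul_conj rs) => /(congr1 io).
by rewrite inj_re ?exprn_ge0 // rmorph0 => /eqP; rewrite sqrf_eq0 normr_eq0 => /eqP.
Qed.

Lemma closed_subspaceT : closed_subspace [set: H].
Proof. by split=> //; exact: closedT. Qed.

(** Riesz representation, relative to a closed subspace: the real parts are handled
    by [form_represents], the rest by [scalar_re_eq0]. *)
Lemma represent_in_subspace (W : set H) (l : H -> K) (M : R) :
  closed_subspace W -> scalar l -> (forall x, `|l x| <= io M * `|x|) ->
  exists2 p, W p & forall w, W w -> dot w p = l w.
Proof.
move=> Ws lL lM.
have lD x y : l (x + y) = l x + l y by have := lL 1 x y; rewrite scale1r mul1r.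
have l0 : l 0 = 0 by apply: (addrI (l 0)); rewrite -lD !addr0.
have lZ c x : l (c *: x) = c * l x by have := lL c x 0; rewrite l0 !addr0.
have [|||||p Wp pl] := @form_represents rdot 1 1 M (re \o l) W rdot_form ltr01 _ _ _ _ _ Ws.
- by move=> x; rewrite mul1r rdotxx.
- by move=> x; rewrite mul1r rdotxx.
- by move=> x y /=; rewrite lD reD.
- by move=> r x /=; rewrite lZ re_injM.
- move=> x /=; have := lM x; rewrite norm_rnorm -rmorphM.
  move=> h; apply: le_trans (re_le rs _) _.
  by rewrite -(inj_le rs) inj_re.
exists p => // w Ww; apply/eqP; rewrite -subr_eq0; apply/eqP.
apply: (@scalar_re_eq0 (fun w => dot w p - l w) W) => //.
- by move=> c x Wx; apply: subspaceZ.
- by move=> c x; rewrite dotZl lZ mulrBr.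
- by move=> x Wx; rewrite reB; have /= <- := pl _ Wx; rewrite /rdot (dotC p) re_conj subrr.
Qed.

Lemma dot_inj x y : (forall z, dot x z = dot y z) -> x = y.
Proof.
move=> h; apply/eqP; rewrite -subr_eq0 -normr_eq0 -sqrf_eq0 dotE dotBl.
by rewrite h subrr.
Qed.

Lemma dotNr x y : dot x (- y) = - dot x y.
Proof. by rewrite -scaleN1r -(rmorph1 io) -rmorphN dot_injr rmorphN1 mulN1r. Qed.

Lemma dotBr x y z : dot z (x - y) = dot z x - dot z y.
Proof. by rewrite dotDr dotNr. Qed.

Lemma dot_eq0C x y : dot x y = 0 -> dot y x = 0.
Proof. by move=> h; rewrite dotC h -(rmorph0 io) conj_inj. Qed.

Lemma orth_projP (W : set H) f : closed_subspace W ->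
  W (orth_proj W f) /\ forall w, W w -> dot (f - orth_proj W f) w = 0.
Proof.
move=> Ws; pose P p := W p /\ forall w, W w -> dot (f - p) w = 0.
suff : exists p, P p by move=> /(xgetPex 0).
have [||p Wp pf] := @represent_in_subspace W (fun x => dot x f) (rnorm f) Ws.
- by move=> c x y; rewrite dotDl dotZl.
- by move=> x; rewrite norm_rnorm -rmorphM mulrC; exact: dot_le.
exists p; split=> // w Ww; apply: dot_eq0C.
by rewrite dotBr pf // subrr.
Qed.

Lemma orth_proj_eq (W : set H) f p : closed_subspace W ->
  W p -> (forall w, W w -> dot (f - p) w = 0) -> orth_proj W f = p.
Proof.
move=> Ws Wp pf; have [Wq qf] := orth_projP f Ws.
set q := orth_proj W f in Wq qf *.
have Wd : W (q - p).
  by apply: (subspaceD Ws Wq); rewrite -scaleN1r; exact: subspaceZ.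
apply/eqP; rewrite -subr_eq0 -normr_eq0 -sqrf_eq0 dotE.
have -> : dot (q - p) (q - p) = dot (f - p) (q - p) - dot (f - q) (q - p).
  rewrite -dotBl; congr (dot _ _).
  by rewrite opprB [RHS]addrC addrA subrK.
by rewrite pf // qf // subrr.
Qed.

Definition selfadjoint (T : H -> H) := forall x y, dot (T x) y = dot x (T y).

Lemma orth_proj_selfadjoint (W : set H) :
  closed_subspace W -> selfadjoint (orth_proj W).
Proof.
move=> Ws x y; have [Wx hx] := orth_projP x Ws; have [Wy hy] := orth_projP y Ws.
rewrite -[in LHS](subrK (orth_proj W y) y) dotDr (dot_eq0C (hy _ Wx)) add0r.
by rewrite -[in RHS](subrK (orth_proj W x) x) dotDl hx // add0r.
Qed.

(** The right-hand side of [dot (T x) z = dot x (T z)] is linear in [x]. *)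
Lemma selfadjoint_linear T : selfadjoint T -> linear T.
Proof.
move=> Tsa c x y; apply: dot_inj => z.
by rewrite Tsa !dotDl !dotZl !Tsa.
Qed.

Lemma selfadjoint_form T : selfadjoint T -> symmetric_form (fun x y => rdot (T x) y).
Proof.
move=> Tsa; have Tl := selfadjoint_linear Tsa; split=> *; rewrite /rdot.
- by rewrite Tsa dotC re_conj.
- by rewrite Tsa dotDl reD -!Tsa.
- by rewrite Tsa dotZl re_injM -Tsa.
Qed.

(** Cauchy-Schwarz for the form [rdot (T x) y] at the pair [(x, T x)], divided by
    [rnorm (T x) ^+ 2]. *)
Lemma selfadjoint_quadratic_bound T (B : R) : selfadjoint T -> 0 < B ->
  (forall x, 0 <= rdot (T x) x) -> (forall x, rdot (T x) x <= B * rnorm x ^+ 2) ->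
  forall x, rnorm (T x) ^+ 2 <= B * rdot (T x) x.
Proof.
move=> Tsa B0 T0 TB x.
have := form_CauchySchwarz (selfadjoint_form Tsa) T0 x (T x).
rewrite rdotxx; set h := rnorm (T x) ^+ 2 => hle.
have h0 : 0 <= h by rewrite sqr_ge0.
have [->|hn0] := eqVneq h 0; first by rewrite mulr_ge0 // ltW.
have hp : 0 < h by rewrite lt_neqAle eq_sym hn0.
rewrite -(ler_pM2r hp) -expr2; apply: le_trans hle _.
by rewrite mulrC -mulrA (mulrC _ h) mulrA ler_wpM2r.
Qed.

Lemma orth_proj_norm (W : set H) f : closed_subspace W ->
  rnorm (orth_proj W f) <= rnorm f.
Proof.
move=> Ws; have [Wf hf] := orth_projP f Ws.
set p := orth_proj W f in Wf hf *.
have [->|p0] := eqVneq (rnorm p) 0; first exact: rnorm_ge0.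
have pp : 0 < rnorm p by rewrite lt_neqAle eq_sym p0 rnorm_ge0.
rewrite -(ler_pM2r pp) -expr2 -rdotxx; apply: le_trans (rdot_le f p).
suff -> : rdot p p = rdot f p by exact: ler_norm.
by apply/esym/eqP; rewrite -subr_eq0 /rdot -reB -dotBl hf // re0.
Qed.

(** The part of [x] orthogonal to [T @` W] is mapped by the self-adjoint [T] into the
    orthogonal complement of [W], where [orth_proj W] vanishes. *)
Lemma orth_proj_image (T : H -> H) (W : set H) x : selfadjoint T ->
  closed_subspace W -> closed_subspace (T @` W) ->
  orth_proj W (T (orth_proj (T @` W) x)) = orth_proj W (T x).
Proof.
move=> Tsa Ws TWs; have [_ hx] := orth_projP x TWs.
set p := orth_proj _ x in hx *.
have [Wq hq] := orth_projP (T p) Ws.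
apply/esym/orth_proj_eq => // w Ww.
have Tl := selfadjoint_linear Tsa.
have -> : T x = T (x - p) + T p by rewrite -[X in X + _]scale1r -Tl scale1r subrK.
rewrite -addrA dotDl hq // addr0 Tsa; apply: hx.
by exists w.
Qed.

End Inner.

(** The norm of [M] has to be taken: on the zero space every scalar [M] satisfies
    the bound, even one that is not real. *)
Lemma operator_bound (H H' : hilbertType conj) (L : H -> H') : bounded_operator L ->
  exists2 M : R, 0 <= M & forall x, rnorm (L x) <= M * rnorm x.
Proof.
move=> [_ [M LM]]; exists (re `|M|); first exact: re_ge0.
move=> x; rewrite -(inj_le rs) rmorphM -!norm_rnorm inj_re //.
by rewrite -(normr_id x) -normrM ger0_norm ?LM // (le_trans _ (LM x)).
Qed.

Lemma adjointP (H H' : hilbertType conj) (L : H -> H') : bounded_operator L ->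
  forall x y, dot (L x) y = dot x (adjoint L y).
Proof.
move=> Lb x y; have [M M0 LM] := operator_bound Lb.
pose P z := forall x, dot (L x) y = dot x z.
suff : exists z, P z by move=> /(xgetPex 0).
have [||z _ zE] := @represent_in_subspace H setT (fun x => dot (L x) y)
    (M * rnorm y) (@closed_subspaceT H).
- by move=> c u w; have [Ll _] := Lb; rewrite Ll dotDl dotZl.
- move=> u; rewrite norm_rnorm -rmorphM; apply: le_trans (dot_le _ _) _.
  by rewrite inj_le mulrAC ler_wpM2r ?rnorm_ge0.
by exists z => u; rewrite zE.
Qed.

(** * Unordered sums *)

#[local] Existing Instance totally_filter.

Section Sums.
Context (I : choiceType).

Lemma partial_sumE (V : zmodType) (x : I -> V) (C : {fset I}) :
  partial_sum x C = \sum_(i <- C) x i.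
Proof. by rewrite (big_seq_fsetE _ C predT). Qed.

Lemma partial_sum_fsetD (V : zmodType) (x : I -> V) (C D : {fset I}) :
  (C `<=` D)%fset ->
  partial_sum x D = partial_sum x C + partial_sum x (D `\` C)%fset.
Proof.
move=> CD; rewrite !partial_sumE (big_fsetID _ (mem C)) /=; congr (_ + _).
  apply: eq_fbigl => i; rewrite !inE /= andbC.
  by case: (boolP (i \in C)) => // /(fsubsetP CD) ->.
by apply: eq_fbigl => i; rewrite !inE /= andbC.
Qed.

Lemma sum_near (V : normedModType K) (x : I -> V) (e : R) :
  cvg (partial_sum x @ totally) -> 0 < e ->
  exists C, forall D, (C `<=` D)%fset -> `|sum x - partial_sum x D| < io e.
Proof.
move=> cx e0; have : 0 < io e by rewrite -(rmorph0 io) inj_lt.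
by move/cvgrPdist_lt : cx => /[apply] -[C _ CP]; exists C.
Qed.

Lemma partial_sum_le (u : I -> K^o) (C : {fset I}) :
  (forall i, 0 <= u i) -> cvg (partial_sum u @ totally) ->
  re (partial_sum u C) <= re (sum u).
Proof.
move=> u0 cu; rewrite leNgt; apply/negP; rewrite -subr_gt0 => e0.
have [D /(_ _ (fsubsetUl D C))] := sum_near cu e0.
rewrite distrC (partial_sum_fsetD u (fsubsetUr D C)).
have : 0 <= partial_sum u ((D `|` C) `\` C)%fset by apply: sumr_ge0.
move/(re_ge0 rs); set w := partial_sum u (_ `\` _)%fset => w0.
rewrite -[X in X < _](inj_re rs) // inj_lt => /(le_lt_trans (re_le rs _)).
rewrite reB reD; lra.
Qed.

Context (H : hilbertType conj).

Lemma bounded_additive_sum_cvg (l : H -> K^o) (M : R) (x : I -> H) :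
  0 <= M -> {morph l : y z / y + z} -> (forall y, `|l y| <= io (M * rnorm y)) ->
  cvg (partial_sum x @ totally) ->
  partial_sum (l \o x) @ totally --> l (sum x).
Proof.
move=> M0 lD lM cx; apply/cvgrPdist_lt => _/(pos_scalar rs)[e e0 ->].
have l0 : l 0 = 0 by apply: (addrI (l 0)); rewrite -lD !addr0.
have M1 : 0 < M + 1 by rewrite ltr_wpDl.
have d0 : 0 < e / (M + 1) by rewrite divr_gt0.
have [C CP] := sum_near cx d0.
exists C => // D /CP; rewrite norm_rnorm inj_lt ltr_pdivlMr // => xD.
have -> : partial_sum (l \o x) D = l (partial_sum x D).
  by rewrite !partial_sumE (big_morph l lD l0).
have -> : l (sum x) - l (partial_sum x D) = l (sum x - partial_sum x D).
  by rewrite -[in l (sum x)](subrK (partial_sum x D) (sum x)) lD addrK.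
apply: le_lt_trans (lM _) _; rewrite inj_lt.
by apply: le_lt_trans xD; rewrite mulrC ler_wpM2l ?rnorm_ge0 // lerDl.
Qed.

Lemma dot_suml_cvg (x : I -> H) y : cvg (partial_sum x @ totally) ->
  partial_sum (fun i => dot (x i) y : K^o) @ totally --> (dot (sum x) y : K^o).
Proof.
apply: (@bounded_additive_sum_cvg (fun z => dot z y) (rnorm y)).
- exact: rnorm_ge0.
- by move=> z t; rewrite dotDl.
- by move=> z; rewrite mulrC dot_le.
Qed.

Lemma dot_sumr_cvg (x : I -> H) y : cvg (partial_sum x @ totally) ->
  partial_sum (fun i => dot y (x i) : K^o) @ totally --> (dot y (sum x) : K^o).
Proof.
apply: (@bounded_additive_sum_cvg (fun z => dot y z) (rnorm y)).
- exact: rnorm_ge0.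
- by move=> z t; rewrite dotDr.
- by move=> z; rewrite dot_le.
Qed.

(** By [selfadjoint_quadratic_bound] for the finite sum of the [T i] over a set of
    indices, the vector sum of the [T i f] over that set is small as soon as the
    scalar sum of the [dot (T i f) f] is. *)
Lemma positive_operators_cvg (T : I -> H -> H) (B : R) f :
  (forall i, selfadjoint (T i)) -> (forall i x, 0 <= dot (T i x) x) -> 0 < B ->
  (forall C x, rdot (partial_sum (T^~ x) C) x <= B * rnorm x ^+ 2) ->
  cvg (partial_sum (fun i => dot (T i f) f : K^o) @ totally) ->
  cvg (partial_sum (T^~ f) @ totally).
Proof.
move=> Tsa T0 B0 TB cu; apply: cauchy_cvg; apply: cauchy_exP.
move=> _/(pos_scalar rs)[e e0 ->].
have d0 : 0 < e ^+ 2 / (2 * B) by rewrite divr_gt0 ?exprn_gt0 // mulr_gt0.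
have [C CP] := sum_near cu d0.
exists (partial_sum (T^~ f) C); exists C => // D CD /=.
rewrite -ball_normE /= (partial_sum_fsetD (T^~ f) CD) opprD addNKr normrN.
set E := (D `\` C)%fset; pose P x := partial_sum (T^~ x) E.
have Psa : selfadjoint P.
  move=> x y; rewrite /P !partial_sumE dot_suml dot_sumr.
  by apply: eq_bigr => i _; exact: Tsa.
have P0 x : 0 <= rdot (P x) x.
  rewrite /rdot /P partial_sumE dot_suml; apply: re_ge0.
  by apply: sumr_ge0 => i _; exact: T0.
rewrite norm_rnorm inj_lt -(@ltr_pXn2r _ 2) ?nnegrE ?rnorm_ge0 ?(ltW e0) //.
apply: le_lt_trans (selfadjoint_quadratic_bound Psa B0 P0 (TB E) f) _.
set u : I -> K^o := fun i => _ in cu CP.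
have -> : rdot (P f) f = re (partial_sum u E).
  by rewrite /rdot /P !partial_sumE dot_suml.
have uE : partial_sum u E = (sum u - partial_sum u C) - (sum u - partial_sum u D).
  by rewrite (partial_sum_fsetD u CD) -/E; ring.
have : `|partial_sum u E| < io (e ^+ 2 / (2 * B) + e ^+ 2 / (2 * B)).
  rewrite uE rmorphD; apply: le_lt_trans (ler_normB _ _) _.
  by apply: ltrD; apply: CP.
rewrite -[X in X < _](inj_re rs) // inj_lt; move/(le_lt_trans (re_le rs _)).
have -> : e ^+ 2 / (2 * B) + e ^+ 2 / (2 * B) = e ^+ 2 / B.
  by field; rewrite gt_eqF.
by rewrite ltr_pdivlMr // mulrC.
Qed.

End Sums.

(** * Coercive self-adjoint operators *)

Section Coercive.
Context (H : hilbertType conj) (S : H -> H) (A B : R).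
Hypothesis Ssa : selfadjoint S.
Hypothesis A0 : 0 < A.
Hypothesis AS : forall x, A * rnorm x ^+ 2 <= rdot (S x) x.
Hypothesis SB : forall x, rdot (S x) x <= B * rnorm x ^+ 2.

Lemma coercive_lower x : A * rnorm x <= rnorm (S x).
Proof.
have [->|x0] := eqVneq (rnorm x) 0; first by rewrite mulr0 rnorm_ge0.
have xp : 0 < rnorm x by rewrite lt_neqAle eq_sym x0 rnorm_ge0.
rewrite -(ler_pM2r xp) -mulrA -expr2; apply: le_trans (AS x) _.
exact: le_trans (ler_norm _) (rdot_le _ _).
Qed.

Lemma coercive_upper x : 0 < B -> rnorm (S x) <= B * rnorm x.
Proof.
move=> B0.
have S0 y : 0 <= rdot (S y) y.
  by apply: le_trans (AS y); rewrite mulr_ge0 ?sqr_ge0 // ltW.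
rewrite -(@ler_pXn2r _ 2) ?nnegrE ?mulr_ge0 ?rnorm_ge0 ?(ltW B0) //.
apply: le_trans (selfadjoint_quadratic_bound Ssa B0 S0 SB x) _.
by rewrite exprMn expr2 -mulrA ler_pM2l.
Qed.

(** Injectivity is [coercive_lower]; a preimage of [g] is the vector representing
    [rdot g] for the form [rdot (S x) y]. *)
Lemma coercive_bij : set_bij [set: H] [set: H] S.
Proof.
have Sl := selfadjoint_linear Ssa.
split=> //.
- move=> x y _ _ Sxy; apply/eqP; rewrite -subr_eq0; apply/eqP.
  apply: (@rnorm0_eq0 H); apply/eqP; rewrite eq_le rnorm_ge0 andbT.
  have := coercive_lower (x - y).
  have -> : S (x - y) = 0 by rewrite addrC -scaleN1r Sl Sxy scaleN1r addNr.
  by rewrite {2}/rnorm normr0 re0 pmulr_rle0.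
- move=> g _.
  have [|||u _ uE] := form_represents (selfadjoint_form Ssa) A0 AS SB
    (l := rdot g) (M := rnorm g) _ _ _ (@closed_subspaceT H).
  + by move=> x y; rewrite /rdot dotDr reD.
  + by move=> r x; rewrite /rdot dot_injr re_injM.
  + by move=> x; exact: le_trans (ler_norm _) (rdot_le _ _).
  exists u => //; apply/eqP; rewrite -subr_eq0; apply/eqP.
  apply: (@rnorm0_eq0 H); apply/eqP; rewrite -sqrf_eq0 -rdotxx.
  by rewrite {1}/rdot dotBl reB -![re _]/(rdot _ _) uE // subrr.
Qed.

Let Sinv := pinv [set: H] S.

Lemma coercive_pinvK : cancel Sinv S.
Proof.
move=> x; apply: pinvK; rewrite inE.
by have [_ _ /(_ x I)] := coercive_bij.
Qed.

Lemma coercive_pinvKV : cancel S Sinv.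
Proof.
move=> x; apply: pinvKV; last by rewrite inE.
by have [_ + _] := coercive_bij.
Qed.

Lemma coercive_pinv_selfadjoint : selfadjoint Sinv.
Proof. by move=> x y; rewrite -{1}(coercive_pinvK y) -Ssa coercive_pinvK. Qed.

Lemma coercive_continuous : 0 < B -> continuous S.
Proof.
move=> B0 x; apply/cvgrPdist_lt => _/(pos_scalar rs)[e e0 ->].
have d0 : 0 < io (e / B) by rewrite -(rmorph0 io) inj_lt divr_gt0.
near=> y.
have -> : S x - S y = S (x - y).
  have Sl := selfadjoint_linear Ssa.
  by rewrite addrC -scaleN1r -Sl scaleN1r addrC.
rewrite norm_rnorm inj_lt; apply: le_lt_trans (coercive_upper _ B0) _.
rewrite mulrC -ltr_pdivlMr // -(inj_lt rs) -norm_rnorm.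
by near: y; apply: cvgr_dist_lt.
Unshelve. all: by end_near.
Qed.

Lemma closed_subspace_pinv (W : set H) : 0 < B ->
  closed_subspace W -> closed_subspace (Sinv @` W).
Proof.
move=> B0 [W0 WD Wcl].
have Sl := selfadjoint_linear coercive_pinv_selfadjoint.
split.
- exists 0 => //; have := Sl (-1) 0 0.
  by rewrite scaler0 addr0 scaleN1r addNr.
- move=> c _ _ [x Wx <-] [y Wy <-]; exists (c *: x + y); first exact: WD.
  exact: Sl.
- have -> : Sinv @` W = S @^-1` W.
    apply/seteqP; split => [_ [x Wx <-]|x Wx] /=; first by rewrite coercive_pinvK.
    by exists (S x) => //; rewrite coercive_pinvKV.
  by apply: preimage_closed => // x _; exact: coercive_continuous.
Qed.

End Coercive.

(** * The g-fusion frame operator *)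

Section Frames.
Context (H : hilbertType conj) (J : set int) (H_ : J -> hilbertType conj).
Context (W : J -> set H) (L : forall j : J, H -> H_ j) (v : J -> K).
Context (frame : gfusion_frame W L v).

Let u (f : H) (j : J) : K^o := v j ^+ 2 * `|L j (orth_proj (W j) f)| ^+ 2.
Let T (j : J) (f : H) : H :=
  v j ^+ 2 *: orth_proj (W j) (adjoint (L j) (L j (orth_proj (W j) f))).

Let dot_T j x y :
  dot (T j x) y = v j ^+ 2 * dot (L j (orth_proj (W j) x)) (L j (orth_proj (W j) y)).
Proof.
have [Ws Lb _ _] := frame.
rewrite /T dotZl (orth_proj_selfadjoint (Ws j)) dotC -(adjointP (Lb j)).
by rewrite -dotC.
Qed.

Let dot_T_diag j x : dot (T j x) x = u x j.
Proof. by rewrite dot_T -dotE. Qed.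

Let gfusion_term_selfadjoint j : selfadjoint (T j).
Proof.
move=> x y; rewrite [RHS]dotC !dot_T (conjM rs) -dotC; congr (_ * _).
have [_ _ v0 _] := frame; have [r _ ->] := pos_scalar rs (v0 j).
by rewrite -rmorphXn conj_inj.
Qed.

Let gfusion_series_ge0 f j : 0 <= u f j.
Proof.
have [_ _ v0 _] := frame.
by rewrite mulr_ge0 // exprn_ge0 // ltW.
Qed.

(** The upper frame bound makes the partial sums of the [T j] uniformly bounded, so
    [positive_operators_cvg] applies; the frame inequalities are then those of the
    quadratic form of the operator. *)
Lemma gfusion_frame_operator_spec : exists A B : R, [/\ 0 < A, A <= B,
  selfadjoint (gfusion_frame_operator W L v) &
  forall f, [/\ cvg (partial_sum (u f) @ totally),
   sum (u f) = io (rdot (gfusion_frame_operator W L v f) f),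
   A * rnorm f ^+ 2 <= rdot (gfusion_frame_operator W L v f) f &
   rdot (gfusion_frame_operator W L v f) f <= B * rnorm f ^+ 2]].
Proof.
have [_ _ _ [A [B [A0 AB hf]]]] := frame.
have B0 := lt_le_trans A0 AB.
have [a a0 aE] := pos_scalar rs A0; have [b b0 bE] := pos_scalar rs B0.
have bnd f : [/\ 0 <= sum (u f), a * rnorm f ^+ 2 <= re (sum (u f)) &
    re (sum (u f)) <= b * rnorm f ^+ 2].
  have [_ h1 h2] := hf f.
  rewrite aE norm_rnorm -rmorphXn -rmorphM in h1.
  rewrite bE norm_rnorm -rmorphXn -rmorphM in h2.
  have s0 : 0 <= sum (u f).
    by apply: le_trans h1; rewrite inj_ge0 mulr_ge0 ?sqr_ge0 // ltW.
  by split=> //; rewrite -(inj_le rs) inj_re.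
have cT f : cvg (partial_sum (T^~ f) @ totally).
  have [cu _ _] := hf f.
  apply: (@positive_operators_cvg _ _ T b) => //.
  - by move=> j x; rewrite dot_T_diag gfusion_series_ge0.
  - move=> C x; have [_ _] := bnd x; apply: le_trans.
    rewrite /rdot partial_sumE dot_suml.
    under eq_bigr do rewrite dot_T_diag.
    rewrite -partial_sumE; apply: partial_sum_le; first exact: gfusion_series_ge0.
    by have [] := hf x.
  - have -> : (fun j => dot (T j f) f : K^o) = u f.
      by apply/funext => j; exact: dot_T_diag.
    exact: cu.
exists a, b; split=> //.
- by rewrite -(inj_le rs) -aE -bE.
- move=> x y.
  have h1 := dot_suml_cvg (y := y) (cT x); have h2 := dot_sumr_cvg (y := x) (cT y).
  have e : (fun i => dot (T i x) y : K^o) = (fun i => dot x (T i y)).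
    by apply/funext => i; exact: gfusion_term_selfadjoint.
  rewrite e in h1; exact: (cvg_unique _ h1 h2).
move=> f; have [cu _ _] := hf f.
have sE : sum (u f) = dot (gfusion_frame_operator W L v f) f.
  have h1 := dot_suml_cvg (y := f) (cT f).
  have e : (fun i => dot (T i f) f : K^o) = u f.
    by apply/funext => i; exact: dot_T_diag.
  rewrite e in h1; exact: (cvg_unique _ cu h1).
by have [s0 h1 h2] := bnd f; rewrite /rdot -sE inj_re.
Qed.

End Frames.

End Hilbert.

(** * The image of a g-fusion frame *)

Theorem theorem3p1 (R : realType) (K : numFieldType) (conj : K -> K)
    (scalars : real_or_complex R conj)
    (H : hilbertType conj) (H_separable : separable H)
    (J : set int) (H_ : J -> hilbertType conj)
    (W : J -> set H) (L : forall j : J, H -> H_ j) (v : J -> K)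
    (frame : gfusion_frame W L v) :
  let S := gfusion_frame_operator W L v in
  let Sinv := pinv [set: H] S in
  gfusion_frame (fun j => Sinv @` W j)
                (fun j => L j \o orth_proj (W j) \o Sinv) v.
Proof.
have [rs] := real_structure_exists scalars.
move=> S Sinv; have [A [B [A0 AB Ssa SP]]] := gfusion_frame_operator_spec rs frame.
have [Ws Lb v0 _] := frame.
have B0 := lt_le_trans A0 AB.
have AS f : A * rnorm rs f ^+ 2 <= rdot rs (S f) f by have [] := SP f.
have SB f : rdot rs (S f) f <= B * rnorm rs f ^+ 2 by have [] := SP f.
have SK : cancel Sinv S := coercive_pinvK Ssa A0 AS SB.
have Tsa : selfadjoint Sinv := coercive_pinv_selfadjoint Ssa A0 AS SB.
have Tl := selfadjoint_linear Tsa.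
have lower f : A * rnorm rs (Sinv f) <= rnorm rs f.
  by rewrite -[f in leRHS]SK; exact: coercive_lower.
have upper f : rnorm rs f <= B * rnorm rs (Sinv f).
  by rewrite -[f in leLHS]SK; exact: (coercive_upper Ssa A0).
have TWs j : closed_subspace (Sinv @` W j) by exact: (closed_subspace_pinv Ssa A0 AS SB).
split=> //.
- move=> j; have [Ll _] := Lb j.
  have Pl := selfadjoint_linear (orth_proj_selfadjoint rs (Ws j)).
  split; first by move=> c x y /=; rewrite Tl Pl Ll.
  have [M M0 LM] := operator_bound rs (Lb j).
  exists (inj rs (M / A)) => x /=.
  rewrite !(norm_rnorm rs) -rmorphM inj_le; apply: le_trans (LM _) _.
  rewrite -mulrA ler_wpM2l //; apply: le_trans (orth_proj_norm _ _ (Ws j)) _.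
  by rewrite mulrC ler_pdivlMr // mulrC.
- exists (inj rs (A / B ^+ 2)), (inj rs (B / A ^+ 2)); split.
  + by rewrite -(rmorph0 (inj rs)) inj_lt divr_gt0 // exprn_gt0.
  + rewrite inj_le ler_pdivrMr ?exprn_gt0 // mulrAC ler_pdivlMr ?exprn_gt0 //.
    by rewrite -!exprS lerXn2r // nnegrE ltW.
  + move=> f u.
    have -> : u = (fun j => v j ^+ 2 * `|L j (orth_proj (W j) (Sinv f))| ^+ 2).
      apply/funext => j /=.
      by rewrite /u /= (orth_proj_image rs f Tsa (Ws j) (TWs j)).
    have [cu -> h1 h2] := SP (Sinv f).
    split=> //.
    * rewrite (norm_rnorm rs) -rmorphXn -rmorphM inj_le; apply: le_trans h1.
      rewrite -mulrA ler_wpM2l ?(ltW A0) // mulrC ler_pdivrMr ?exprn_gt0 //.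
      by rewrite mulrC -exprMn lerXn2r ?nnegrE ?mulr_ge0 ?rnorm_ge0 // ltW.
    * rewrite (norm_rnorm rs) -rmorphXn -rmorphM inj_le; apply: le_trans h2 _.
      rewrite -mulrA ler_wpM2l ?(ltW B0) // mulrC ler_pdivlMr ?exprn_gt0 //.
      by rewrite mulrC -exprMn lerXn2r ?nnegrE ?mulr_ge0 ?rnorm_ge0 // ltW.
Qed.
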